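(* Fix $n\ge 1$ and let $F_{1111}(n)$ be the number of zero-one matrices (of any size) with exactly $n$ ones and no zero row or zero column. Define a probability distribution on pairs of nonnegative integers by \[ \rho_{k,l}=\frac{1}{F_{1111}(n)}\binom{kl}{n}2^{-k-l-2}. \] Consider the following random procedure: (i) draw integers $K,L$ with joint distribution $\rho_{k,l}$; (ii) choose a zero-one matrix with $K$ rows, $L$ columns and exactly $n$ ones (and $KL-n$ zeros) uniformly at random; (iii) delete all rows and all columns all of whose entries are $0$. Then the output is uniformly distributed over the set of zero-one matrices with exactly $n$ ones and no zero row or column, i.e. each such matrix is produced with probability $1/F_{1111}(n)$.
   Context: Matrices are counted as arrays: the order of rows and columns matters and repeated rows or columns are allowed. The fact that $\rho_{k,l}$ sums to $1$ is part of the setting (it follows from the identity $F_{1111}(n)=\sum_{k,l\ge0}2^{-k-l-2}\binom{kl}{n}$). *)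

(* Defs.v *)
From HB Require Import structures.
From mathcomp Require Import all_boot all_order all_algebra finmap.
From mathcomp Require Import all_classical all_reals all_analysis.

Set Implicit Arguments.
Unset Strict Implicit.
Unset Printing Implicit Defensive.

Import Order.TTheory GRing.Theory Num.Theory.

Local Open Scope ring_scope.

Section FixedSize.
Variables k l : nat.
Implicit Type A : 'M[bool]_(k, l).

Definition ones A : nat := #|[pred ij : 'I_k * 'I_l | A ij.1 ij.2]|.

Definition nonzero_row A : pred 'I_k := [pred i | [exists j, A i j]].

Definition nonzero_col A : pred 'I_l := [pred j | [exists i, A i j]].

(* [enum_val] enumerates ordinals in increasing order, so the relative order
   of the remaining rows and columns is unchanged. *)
Definition delete_zeros A : 'M[bool]_(#|nonzero_row A|, #|nonzero_col A|) :=
  mxsub (@enum_val _ (nonzero_row A)) (@enum_val _ (nonzero_col A)) A.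

Definition no_zero_line A : bool :=
  [forall i, nonzero_row A i] && [forall j, nonzero_col A j].

End FixedSize.

(* zero-one matrices of arbitrary size, tagged with (#rows, #columns) *)
Definition zmat : Type := {kl : nat * nat & 'M[bool]_(kl.1, kl.2)}.

Definition to_zmat (k l : nat) (A : 'M[bool]_(k, l)) : zmat :=
  @Tagged (nat * nat) (k, l) (fun kl => 'M[bool]_(kl.1, kl.2)) A.

HB.instance Definition _ := Countable.on zmat.

HB.instance Definition _ := isPointed.Build zmat
  (@to_zmat 0 0 (const_mx false)).

HB.instance Definition _ := @isMeasurable.Build default_measure_display
  zmat discrete_measurable discrete_measurable0
  discrete_measurableC discrete_measurableU.

Definition strip (A : zmat) : zmat := to_zmat (delete_zeros (tagged A)).

Local Open Scope classical_set_scope.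

Definition F1111_set (n : nat) : set zmat :=
  [set A | ones (tagged A) = n /\ no_zero_line (tagged A)].

Lemma ones_ge_size (k l : nat) (A : 'M[bool]_(k, l)) :
  no_zero_line A -> (k <= ones A)%N && (l <= ones A)%N.
Proof.
case/andP => /forallP nzr /forallP nzc; apply/andP; split.
- pose p := [pred ij : 'I_k * 'I_l | A ij.1 ij.2].
  rewrite -[leqLHS]card_ord; apply: leq_trans (leq_image_card fst p).
  apply: subset_leq_card; apply/fintype.subsetP => i _.
  by have /existsP[j Aij] := nzr i; apply/fintype.imageP; exists (i, j).
- pose p := [pred ij : 'I_k * 'I_l | A ij.1 ij.2].
  rewrite -[leqLHS]card_ord; apply: leq_trans (leq_image_card snd p).
  apply: subset_leq_card; apply/fintype.subsetP => j _.
  by have /existsP[i Aij] := nzc j; apply/fintype.imageP; exists (i, j).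
Qed.

(* [fset_set] is only meaningful on finite sets, so this is what makes
   [F1111] below the actual number of matrices. *)
Lemma finite_F1111_set (n : nat) : finite_set (F1111_set n).
Proof.
pose T := {kl : 'I_n.+1 * 'I_n.+1 & 'M[bool]_(kl.1, kl.2)}.
pose f (x : T) : zmat := to_zmat (tagged x).
apply: (@sub_finite_set _ _ (f @` [set: T])); last first.
  by apply: finite_image; exact: finite_finset.
move=> [[k l] A] /= [nA /ones_ge_size /=]; rewrite nA => /andP[kn ln].
by exists (@Tagged ('I_n.+1 * 'I_n.+1)%type
  (Ordinal (kn : (k < n.+1)%N), Ordinal (ln : (l < n.+1)%N))
  (fun kl => 'M[bool]_(kl.1, kl.2)) A).
Qed.

Definition F1111 (n : nat) : nat := #|` fset_set (F1111_set n)|%fset.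

Definition rho (R : realType) (n k l : nat) : R :=
  (F1111 n)%:R^-1 * 'C(k * l, n)%:R * 2 ^- (k + l + 2).

(* P(A | B); only meaningful when P B != 0 *)
Definition cond_prob (R : realType) (d : measure_display)
    (Omega : measurableType d) (P : probability Omega R)
    (A B : set Omega) : R :=
  fine (P (A `&` B)) / fine (P B).

(* Main.v *)
(* A full p x q matrix B is obtained by deleting the zero lines of exactly
   C(k,p) C(l,q) matrices of size k x l: choose which rows and columns survive.
   Under the procedure every k x l matrix with n ones has probability
   2^(-k-l-2) / F(n), and sum_k C(k,p) 2^(-k-1) = 1 for every p, so B is produced
   with probability 1 / F(n).  Counting all matrices with n ones through their
   stripped form gives sum_(k,l) C(kl,n) 2^(-k-l-2) = F(n) in the same way. *)
Require Import Defs.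
From HB Require Import structures.
From mathcomp Require Import all_boot all_order all_algebra finmap.
From mathcomp Require Import all_classical all_reals all_analysis.
From mathcomp Require Import ring lra.

Set Implicit Arguments.
Unset Strict Implicit.
Unset Printing Implicit Defensive.

Import Order.TTheory GRing.Theory Num.Theory.
Import numFieldNormedType.Exports.

Local Open Scope ring_scope.

(** * Inserting zero lines, and the size of a fiber of [strip] *)

Definition entry (B : zmat) (u v : nat) : bool :=
  if insub u is Some i then
    if insub v is Some j then tagged B i j else false
  else false.

Lemma entryE (B : zmat) (i : 'I_(tag B).1) (j : 'I_(tag B).2) :
  entry B i j = tagged B i j.
Proof. by rewrite /entry !valK. Qed.

(** Reading [C] at natural-number indices through [entry] avoids transporting a matrix along the
    equality of sizes. *)
Lemma zmat_eq (B C : zmat) : tag B = tag C ->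
  (forall i j, tagged B i j = entry C i j) -> B = C.
Proof.
case: B C => [kl B] [kl' C] /= e; subst kl' => BC.
by congr existT; apply/matrixP => i j; rewrite BC entryE.
Qed.

Section Embedding.
Variables k l : nat.
Implicit Types (A : 'M[bool]_(k, l)) (X : {set 'I_k}) (Y : {set 'I_l}).

(** Right inverse of deletion on full matrices: [index i (enum X)] is the rank of [i] in [X], in the
    same order as the [enum_val] of [delete_zeros]. *)
Definition embed (b : nat -> nat -> bool) X Y : 'M[bool]_(k, l) :=
  \matrix_(i, j)
    [&& i \in X, j \in Y & b (index i (enum X)) (index j (enum Y))].

Lemma index_enum_val (T : finType) (P : {pred T}) (u : 'I_#|P|) :
  index (enum_val u) (enum P) = u.
Proof. by rewrite /enum_val index_uniq ?enum_uniq// -cardE. Qed.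

Lemma index_enum_lt (T : finType) (P : {pred T}) (x : T) :
  x \in P -> (index x (enum P) < #|P|)%N.
Proof. by move=> Px; rewrite cardE index_mem mem_enum. Qed.

Lemma entry_strip A i j : i \in nonzero_row A -> j \in nonzero_col A ->
  entry (strip (to_zmat A))
    (index i (enum (nonzero_row A))) (index j (enum (nonzero_col A))) = A i j.
Proof.
move=> ri cj.
rewrite (entryE (B := strip (to_zmat A)) (Ordinal (index_enum_lt ri))
  (Ordinal (index_enum_lt cj))) /= mxE /enum_val /=.
by rewrite !nth_index ?mem_enum.
Qed.

(** Off the nonzero rows and columns every entry is zero, so the stripped form and the two surviving
    index sets determine [A]. *)
Lemma embed_strip A :
  A = embed (entry (strip (to_zmat A)))
    [set i in nonzero_row A]%SET [set j in nonzero_col A]%SET.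
Proof.
apply/matrixP => i j; rewrite mxE !finset.in_set.
rewrite (eq_enum (finset.in_set (mem (nonzero_row A)))).
rewrite (eq_enum (finset.in_set (mem (nonzero_col A)))).
have [ri|nri] /= := boolP (i \in nonzero_row A); last first.
  by apply: contraNF nri => Aij; apply/existsP; exists j.
have [cj|ncj] /= := boolP (j \in nonzero_col A); last first.
  by apply: contraNF ncj => Aij; apply/existsP; exists i.
by rewrite entry_strip.
Qed.

Section Strip.
Variables (B : zmat) (X : {set 'I_k}) (Y : {set 'I_l}).
Hypotheses (B_full : no_zero_line (tagged B)).
Hypotheses (cardX : #|X| = (tag B).1) (cardY : #|Y| = (tag B).2).

Let A := embed (entry B) X Y.

(** A row in [X] carries a row of [B], which contains a one; column [v] of [B] is placed at the
    [v]-th element of [Y], whence the witness. *)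
Lemma nonzero_row_embed : nonzero_row A =i X.
Proof.
move=> i; apply/existsP/idP => [[j]|iX]; first by rewrite mxE => /andP[].
have ip := index_enum_lt iX; rewrite cardX in ip.
have /andP[/forallP/(_ (Ordinal ip))/existsP[v Bv] _] := B_full.
have vY : (v < #|Y|)%N by rewrite cardY.
exists (enum_val (Ordinal vY)).
rewrite mxE iX enum_valP index_enum_val /=.
by move: Bv; rewrite -entryE.
Qed.

Lemma nonzero_col_embed : nonzero_col A =i Y.
Proof.
move=> j; apply/existsP/idP => [[i]|jY]; first by rewrite mxE => /and3P[].
have jq := index_enum_lt jY; rewrite cardY in jq.
have /andP[_ /forallP/(_ (Ordinal jq))/existsP[u Bu]] := B_full.
have uX : (u < #|X|)%N by rewrite cardX.
exists (enum_val (Ordinal uX)).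
rewrite mxE jY enum_valP index_enum_val /=.
by move: Bu; rewrite -entryE.
Qed.

Lemma strip_embed : strip (to_zmat A) = B.
Proof.
apply: zmat_eq => /= [|u v].
  rewrite (eq_card nonzero_row_embed) (eq_card nonzero_col_embed) cardX cardY.
  by case: (B) => -[].
rewrite mxE mxE -nonzero_row_embed -nonzero_col_embed !enum_valP /=.
rewrite -(eq_enum nonzero_row_embed) -(eq_enum nonzero_col_embed).
by rewrite !index_enum_val.
Qed.

End Strip.

(** The pairs [(X, Y)] of index sets with the dimensions of [B] correspond to the fiber through
    [embed]. This is injective because [X] and [Y] are recovered as the nonzero rows and columns. *)
Lemma card_strip_fiber (B : zmat) : no_zero_line (tagged B) ->
  #|[pred A : 'M[bool]_(k, l) | strip (to_zmat A) == B]| =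
  ('C(k, (tag B).1) * 'C(l, (tag B).2))%N.
Proof.
move=> Bf.
pose D := finset.setX [set X : {set 'I_k} | #|X| == (tag B).1]%SET
  [set Y : {set 'I_l} | #|Y| == (tag B).2]%SET.
have <- : #|D| = ('C(k, (tag B).1) * 'C(l, (tag B).2))%N.
  by rewrite cardsX !card_draws !card_ord.
pose f (XY : {set 'I_k} * {set 'I_l}) := embed (entry B) XY.1 XY.2.
have DP XY : XY \in D -> #|XY.1| = (tag B).1 /\ #|XY.2| = (tag B).2.
  by rewrite !inE => /andP[/eqP ? /eqP ?].
rewrite -(@card_in_imset _ _ f D) => [|[X Y] [X' Y'] /DP[/= X1 Y1] /DP[/= X2 Y2] e].
  apply: eq_card => A; rewrite !inE; apply/eqP/imsetP => [AB|[XY /DP[? ?] ->]].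
    exists ([set i in nonzero_row A]%SET, [set j in nonzero_col A]%SET).
      by rewrite !inE !cardsE -AB !eqxx.
    by rewrite /f -AB; exact: embed_strip.
  exact: strip_embed.
congr pair; apply/setP => i.
  by rewrite -(nonzero_row_embed Bf X1 Y1) -(nonzero_row_embed Bf X2 Y2) -/(f (_, _)) e.
by rewrite -(nonzero_col_embed Bf X1 Y1) -(nonzero_col_embed Bf X2 Y2) -/(f (_, _)) e.
Qed.

(** A zero-one matrix amounts to its support, an [n]-subset of the [k * l] positions. *)
Lemma card_ones (n : nat) :
  #|[pred A : 'M[bool]_(k, l) | ones A == n]| = 'C(k * l, n).
Proof.
pose supp A := [set ij : 'I_k * 'I_l | A ij.1 ij.2]%SET.
have supp_inj : injective supp.
  move=> A A' /setP AA'; apply/matrixP => i j.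
  by have := AA' (i, j); rewrite !inE.
rewrite -[k in RHS]card_ord -[l in RHS]card_ord -card_prod -card_draws.
rewrite -(card_imset _ supp_inj); apply: eq_card => S; rewrite [RHS]inE.
apply/imsetP/eqP => [[A /eqP <- ->]|Sn]; first by rewrite cardsE.
have SE : S = supp (\matrix_(i, j) ((i, j) \in S)).
  by apply/setP => -[i j]; rewrite !inE mxE.
exists (\matrix_(i, j) ((i, j) \in S)) => //.
by rewrite inE; apply/eqP; rewrite -Sn [in RHS]SE cardsE.
Qed.

(** Every one lies in a nonzero row and a nonzero column, so none is deleted. *)
Lemma ones_delete_zeros A : ones (delete_zeros A) = ones A.
Proof.
pose f (uv : 'I_#|nonzero_row A| * 'I_#|nonzero_col A|) :=
  (enum_val uv.1, enum_val uv.2).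
have f_inj : injective f by move=> [u v] [u' v'] [/enum_val_inj -> /enum_val_inj ->].
rewrite /ones -(fintype.card_image f_inj); apply: eq_card => -[i j].
apply/fintype.imageP/idP => [[[u v] /=]|Aij].
  by rewrite !inE /= mxE => Auv [-> ->].
have ri : i \in nonzero_row A by apply/existsP; exists j.
have cj : j \in nonzero_col A by apply/existsP; exists i.
exists (enum_rank_in ri i, enum_rank_in cj j).
  by rewrite !inE /= mxE !enum_rankK_in.
by rewrite /f /= !enum_rankK_in.
Qed.

(** A one in a surviving row lies in a surviving column, and conversely, so a single pass of
    deletion creates no new zero line. *)
Lemma no_zero_line_delete_zeros A : no_zero_line (delete_zeros A).
Proof.
apply/andP; split; apply/forallP => u.
  have /existsP[j Aj] := enum_valP u.
  have cj : j \in nonzero_col A by apply/existsP; exists (enum_val u).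
  by apply/existsP; exists (enum_rank_in cj j); rewrite mxE enum_rankK_in.
have /existsP[i Ai] := enum_valP u.
have ri : i \in nonzero_row A by apply/existsP; exists (enum_val u).
by apply/existsP; exists (enum_rank_in ri i); rewrite mxE enum_rankK_in.
Qed.

End Embedding.

Local Open Scope classical_set_scope.

(** * The series of [C(k, p) / 2^(k+1)] over [k] *)

Section BinomialSeries.
Variable R : realType.

Let u p k : R := 'C(k, p)%:R * 2 ^- k.+1.

Let u_ge0 p k : 0 <= u p k.
Proof. by rewrite mulr_ge0// invr_ge0 exprn_ge0. Qed.

Let series_nd p : {homo series (u p) : m n / (m <= n)%N >-> m <= n}.
Proof. exact: nondecreasing_series. Qed.

(* In the limit this reads s = (s + 1) / 2, which forces s = 1. *)
Let series_recl p N :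
  series (u p.+1) N.+1 = 2^-1 * (series (u p.+1) N + series (u p) N).
Proof.
rewrite seriesEnat /= big_nat_recl// {1}/u bin0n mul0r add0r.
rewrite seriesEnat /= -big_split mulr_sumr /=; apply: eq_bigr => k _.
by rewrite /u binS natrD exprS invfM -mulrDl mulrCA.
Qed.

(** Induction on [p]: the base case is a geometric series, and the recurrence from Pascal's rule
    determines the next limit once convergence is known. *)
Lemma cvg_series_bin p : series (u p) @ \oo --> (1 : R).
Proof.
elim: p => [|p IHp].
  have -> : u 0 = geometric 2^-1 2^-1.
    by apply/funext => k; rewrite /u /geometric /= bin0 mul1r exprVn exprS invfM.
  rewrite [X in _ --> X](_ : 1 = 2^-1 / (1 - 2^-1)); last by field.
  by apply: cvg_geometric_series; rewrite ger0_norm; lra.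
have le1 N : series (u p) N <= 1.
  rewrite -(cvg_lim _ IHp)//; apply: nondecreasing_cvgn_le => //.
  by apply/cvg_ex; exists 1.
have cv : cvgn (series (u p.+1)).
  apply: nondecreasing_is_cvgn; first exact: series_nd.
  exists 1 => _ [N _ <-].
  (* Let [S] and [T] be the partial sums for [p.+1] and [p]. Monotonicity and the recurrence give
     [S N <= (S N + T N) / 2], hence [S N <= T N <= 1]. *)
  by have := series_nd p.+1 (leqnSn N); have := le1 N; rewrite series_recl; lra.
set s := limn (series (u p.+1)).
have cs : series (u p.+1) @ \oo --> s by [].
suff -> : 1 = s by [].
have : 2^-1 * (series (u p.+1) N + series (u p) N) @[N --> \oo] --> 2^-1 * (s + 1).
  by apply: cvgMr; exact: cvgD.
under eq_fun do rewrite -series_recl.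
move: cs; rewrite -cvg_shiftS => /(cvg_unique _) /[apply] /(_ (@Rhausdorff R)) e.
lra.
Qed.

Lemma esum_bin p : \esum_(k in [set: nat]) ('C(k, p)%:R * 2 ^- k.+1 : R)%:E = 1%E.
Proof.
rewrite -nneseries_esumT; last by move=> k; rewrite lee_fin; exact: u_ge0.
rewrite [LHS](_ : _ = limn (EFin \o series (u p))); last first.
  by congr (limn _); apply/funext => N /=; rewrite sumEFin.
rewrite EFin_lim ?(cvg_lim _ (@cvg_series_bin p))//.
exact: cvg_series_bin.
Qed.

End BinomialSeries.

(** * Sums of nonnegative families: scaling, products and fibers *)

Lemma esumZl (R : realType) (T : choiceType) (D : set T) (c : R)
    (f : T -> R) : 0 <= c -> (forall i, 0 <= f i) ->
  \esum_(i in D) (c * f i)%:E = (c%:E * \esum_(i in D) (f i)%:E)%E.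
Proof.
move=> c0 f0; rewrite /esum -ereal_supZl//; last first.
  by apply/set0P; exists 0%E; exists set0; rewrite ?fsbig_set0//; exact: fsets_set0.
congr ereal_sup; rewrite image_comp; apply: eq_imagel => /= X [finX _].
by rewrite !fsbig_finite//= !sumEFin -EFinM mulr_sumr.
Qed.

Lemma esum_prod (R : realType) (T1 T2 : choiceType) (f : T1 -> R)
    (g : T2 -> R) : (forall i, 0 <= f i) -> (forall j, 0 <= g j) ->
  \esum_(ij in [set: T1 * T2]) (f ij.1 * g ij.2)%:E =
  \esum_(i in [set: T1]) ((f i)%:E * \esum_(j in [set: T2]) (g j)%:E)%E.
Proof.
move=> f0 g0; under [RHS]eq_esum do rewrite -esumZl//.
rewrite esum_esum => [|i j _ _]; last by rewrite lee_fin mulr_ge0.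
by congr esum; apply/seteqP.
Qed.

(** Each [x] in [S] lies in exactly one fiber, so the pairs [(f x, x)] project bijectively onto
    [S]. *)
Lemma esum_fibers (R : realType) (T U : choiceType) (S : set T) (D : set U)
    (f : T -> U) (a : T -> \bar R) :
  (forall x, S x -> D (f x)) -> (forall x, S x -> (0 <= a x)%E) ->
  \esum_(x in S) a x =
  \esum_(y in D) \esum_(x in [set x | S x /\ f x = y]) a x.
Proof.
move=> SD a0; rewrite esum_esum => [|y x _ [Sx _]]; last exact: a0.
apply: (reindex_esum _ _ (@snd U T)); split=> /=.
- by move=> [y x] [_ []].
- by move=> [y1 x1] [y2 x2] /set_mem[_ [_ /= <-]] /set_mem[_ [_ /= <-]] ->.
- by move=> x Sx; exists (f x, x) => //; split=> //; exact: SD.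
Qed.

Lemma esum_const_finType (R : realType) (T : finType) (P : pred T) (c : R) :
  0 <= c -> \esum_(i in [set i | P i]) c%:E = (#|P|%:R * c)%:E.
Proof.
move=> c0; have -> : [set i | P i] = [set` enum P].
  by apply/seteqP; split=> i /=; rewrite mem_enum.
rewrite esum_fset ?finite_seq// -fsbig_seq ?enum_uniq//.
by rewrite sumEFin big_const_seq count_predT -cardE iter_addr_0 mulr_natl.
Qed.

(** * Weighted sums over matrices of all sizes *)

Lemma F1111_set_strip (A : zmat) : F1111_set (ones (tagged A)) (strip A).
Proof.
by split; [exact: ones_delete_zeros | exact: no_zero_line_delete_zeros].
Qed.

Lemma ones_strip (A : zmat) : ones (tagged (strip A)) = ones (tagged A).
Proof. exact: ones_delete_zeros. Qed.

Lemma F1111_gt0 n : (0 < n)%N -> (0 < F1111 n)%N.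
Proof.
move=> n0; rewrite /F1111 cardfs_gt0; apply/fset0Pn.
(* A single row of [n] ones; it is a nonzero row because [n] is positive. *)
exists (@to_zmat 1 n (const_mx true)).
rewrite in_fset_set; last exact: finite_F1111_set.
rewrite inE; split=> /=.
  rewrite /ones (eq_card (B := predT)) => [|ij]; last by rewrite !inE mxE.
  by rewrite card_prod !card_ord mul1n.
apply/andP; split; apply/forallP => i; apply/existsP.
  by exists (Ordinal n0); rewrite mxE.
by exists ord0; rewrite mxE.
Qed.

Lemma esum_zmat (R : realType) (S : set zmat) (h : nat * nat -> R) :
  (forall kl, 0 <= h kl) ->
  \esum_(A in S) (h (tag A))%:E =
  \esum_(kl in [set: nat * nat])
    (#|[pred A : 'M[bool]_(kl.1, kl.2) | `[< S (to_zmat A) >]]|%:R * h kl)%:E.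
Proof.
move=> h0; pose J kl := [set A : zmat | S A /\ tag A = kl].
rewrite (@esum_fibers _ _ _ _ [set: nat * nat] (@tag _ _))//; last first.
  by move=> A _; rewrite lee_fin.
apply: eq_esum => -[k l] _ /=.
rewrite -/(J (k, l)); have -> : J (k, l) = @to_zmat k l @` [set A | `[< S (to_zmat A) >]].
  apply/seteqP; split=> [[kl A] [/= SA e]|_ [A /asboolP SA <-]] //.
  by subst kl; exists A => //; exact/asboolP.
rewrite esum_image => [|A A' _ _ /eqP]; last by rewrite eq_Tagged => /eqP.
exact: esum_const_finType (h0 (k, l)).
Qed.

(** For a matrix with [n] ones, this is [F1111 n] times its probability of being drawn in step (ii):
    the binomial in [rho] cancels against the uniform choice. *)
Definition weight (R : realType) (kl : nat * nat) : R := 2 ^- (kl.1 + kl.2 + 2).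

Lemma weight_ge0 (R : realType) kl : 0 <= weight R kl.
Proof. by rewrite invr_ge0 exprn_ge0. Qed.

(** By the fiber count and [2^-(k+l+2) = 2^-(k+1) * 2^-(l+1)], the sum factors into two binomial
    series, each equal to 1. *)
Lemma esum_weight_fiber (R : realType) (B : zmat) : no_zero_line (tagged B) ->
  \esum_(A in [set A | strip A = B]) (weight R (tag A))%:E = 1%E.
Proof.
move=> Bf; rewrite esum_zmat; last exact: weight_ge0.
pose c p k : R := 'C(k, p)%:R * 2 ^- k.+1.
have c0 p k : 0 <= c p k by rewrite mulr_ge0// invr_ge0 exprn_ge0.
transitivity (\esum_(kl in [set: nat * nat])
    (c (tag B).1 kl.1 * c (tag B).2 kl.2)%:E); last first.
  rewrite esum_prod//; under eq_esum do rewrite esum_bin mule1.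
  exact: esum_bin.
apply: eq_esum => -[k l] _ /=.
have -> : #|[pred A : 'M[bool]_(k, l) | `[< strip (to_zmat A) = B >]]| =
    ('C(k, (tag B).1) * 'C(l, (tag B).2))%N.
  rewrite -card_strip_fiber//; apply: eq_card => A.
  by rewrite !inE; apply/asboolP/eqP.
congr (_%:E); rewrite natrM /c /weight mulrACA -invfM -exprD.
by congr (_ * _ ^- _); rewrite /= addn2 addSn addnS.
Qed.

(** Grouped by stripped form, each full matrix with [n] ones contributes 1. *)
Lemma esum_weight_ones (R : realType) n :
  \esum_(A in [set A : zmat | ones (tagged A) = n]) (weight R (tag A))%:E =
  (F1111 n)%:R%:E.
Proof.
rewrite (@esum_fibers _ _ _ _ (F1111_set n) strip) => [|A <-|A _]; last 2 first.
- exact: F1111_set_strip.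
- by rewrite lee_fin weight_ge0.
have fiberE B : F1111_set n B ->
    [set A : zmat | ones (tagged A) = n /\ strip A = B] = [set A | strip A = B].
  move=> [Bn _]; apply/seteqP; split=> [A []//|A /= AB]; split=> //.
  by rewrite -Bn -AB ones_strip.
under eq_esum => B FB do rewrite fiberE// esum_weight_fiber ?(proj2 FB)//.
exact/finite_card_sum/finite_F1111_set.
Qed.

(** The sum of [esum_weight_ones], grouped by size instead. *)
Lemma esum_bin_mul (R : realType) n :
  \esum_(kl in [set: nat * nat]) ('C(kl.1 * kl.2, n)%:R * weight R kl)%:E =
  (F1111 n)%:R%:E.
Proof.
rewrite -esum_weight_ones esum_zmat; last exact: weight_ge0.
apply: eq_esum => -[k l] _ /=; rewrite -card_ones.
by congr ((_%:R * _)%:E); apply: eq_card => A; rewrite !inE; apply/eqP/asboolP.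
Qed.

(** * The law of the output of the procedure *)

Section Distribution.
Variables (R : realType) (n : nat).
Hypothesis n_gt0 : (0 < n)%N.

Lemma rhoE k l :
  rho R n k l = (F1111 n)%:R^-1 * ('C(k * l, n)%:R * weight R (k, l)).
Proof. by rewrite /rho mulrA. Qed.

Lemma rho_ge0 k l : 0 <= rho R n k l.
Proof. by rewrite rhoE !mulr_ge0// ?weight_ge0// invr_ge0. Qed.

Lemma F1111_neq0 : (F1111 n)%:R != 0 :> R.
Proof. by rewrite pnatr_eq0 -lt0n F1111_gt0. Qed.

Lemma esum_rho : \esum_(kl in [set: nat * nat]) (rho R n kl.1 kl.2)%:E = 1%E.
Proof.
under eq_esum => kl _ do rewrite rhoE -surjective_pairing.
rewrite esumZl ?invr_ge0//; last by move=> kl; rewrite mulr_ge0// weight_ge0.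
by rewrite esum_bin_mul -EFinM mulVf// F1111_neq0.
Qed.

Variables (d : measure_display) (Omega : measurableType d).
Variables (P : probability Omega R) (K L : {RV P >-> nat}) (M : {RV P >-> zmat}).
Hypothesis KL_rho : forall k l : nat,
  P [set w | K w = k /\ L w = l] = (rho R n k l)%:E.
Hypothesis M_unif : forall k l : nat, P [set w | K w = k /\ L w = l] != 0%E ->
  forall A : 'M[bool]_(k, l), ones A = n ->
  cond_prob P [set w | M w = to_zmat A] [set w | K w = k /\ L w = l] =
    #|[pred A' : 'M[bool]_(k, l) | ones A' == n]|%:R^-1.

(** [M_unif] constrains [M] only given [(K, L)], so the size drawn is recorded along with the
    matrix. *)
Let event (A : zmat) : set Omega :=
  [set w | M w = A] `&` [set w | K w = (tag A).1 /\ L w = (tag A).2].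

Let measurable_M (S : set zmat) : measurable [set w | S (M w)].
Proof. exact: (measurable_funPTI M). Qed.

Let measurable_KL k l : measurable [set w | K w = k /\ L w = l].
Proof.
apply: measurableI.
  exact: (measurable_funPTI K (Y := [set k])).
exact: (measurable_funPTI L (Y := [set l])).
Qed.

Let measurable_event A : measurable (event A).
Proof. by apply: measurableI => //; exact: (measurable_M [set A]). Qed.

Lemma prob_event (A : zmat) : ones (tagged A) = n ->
  P (event A) = ((F1111 n)%:R^-1 * weight R (tag A))%:E.
Proof.
case: A => -[k l] A /= An.
(* [A] itself is a matrix with [n] ones, so its size has positive probability and conditioning on it
   is legitimate. *)
have binN0 : 'C(k * l, n)%:R != 0 :> R.
  rewrite pnatr_eq0 -lt0n -card_ones; apply/card_gt0P.
  by exists A; rewrite inE An.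
have w0 : weight R (k, l) != 0 by rewrite invr_eq0 expf_neq0// pnatr_eq0.
have r0 : rho R n k l != 0.
  by rewrite rhoE !mulf_neq0// invr_eq0 F1111_neq0.
have KL0 : P [set w | K w = k /\ L w = l] != 0%E by rewrite KL_rho.
have := M_unif KL0 An; rewrite /cond_prob KL_rho /= card_ones => /(canRL (mulfVK r0)).
rewrite -[X in fine (P X)]/(event (to_zmat A)) => e.
rewrite -[P _]fineK ?fin_num_measure// e rhoE.
by congr (_%:E); rewrite mulrCA mulKf.
Qed.

(** The events of distinct matrices are disjoint, and those of matrices in [S] lie in the right-hand
    event. Finite additivity bounds every finite partial sum, hence their supremum. *)
Lemma prob_ge (S : set zmat) :
  (\esum_(A in [set A : zmat | ones (tagged A) = n] `&` S)
    ((F1111 n)%:R^-1 * weight R (tag A))%:E <= P [set w | S (M w)])%E.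
Proof.
apply: ge_ereal_sup => _ [X [finX XS] <-].
rewrite (eq_fsbigr (P \o event)) => [|A /set_mem/XS[An _]]; last first.
  by rewrite /= prob_event.
rewrite -measure_fin_bigcup//.
- apply: le_measure; rewrite ?inE//.
    exact: fin_bigcup_measurable.
  by move=> w [A /XS[_ SA] [/= -> _]].
- by move=> A A' _ _ [w [[<- _] [<- _]]].
Qed.

(* The lower bounds for a set and for its complement add up to 1, so both are
   attained. *)
Lemma prob_strip (B : zmat) : F1111_set n B ->
  P [set w | strip (M w) = B] = ((F1111 n)%:R^-1)%:E.
Proof.
move=> [Bn Bf].
set c : R := (F1111 n)%:R^-1.
have c0 : 0 <= c by rewrite invr_ge0.
pose S := [set A | strip A = B].
pose Z := [set A : zmat | ones (tagged A) = n].
have S_eq : \esum_(A in Z `&` S) (c * weight R (tag A))%:E = c%:E.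
  (* Stripping preserves the number of ones, so the whole fiber of [B] lies in [Z]. *)
  have -> : Z `&` S = S.
    by apply/setIidr => A /= AB; rewrite /Z /= -ones_strip AB.
  by rewrite esumZl ?esum_weight_fiber ?mule1// => A; exact: weight_ge0.
have tot : \esum_(A in Z) (c * weight R (tag A))%:E = 1%E.
  rewrite esumZl ?esum_weight_ones// => [|A]; last exact: weight_ge0.
  by rewrite -EFinM mulVf// F1111_neq0.
have := prob_ge S; have := prob_ge (~` S); move: tot.
rewrite (esumID S); last by move=> A _; rewrite lee_fin mulr_ge0// weight_ge0.
rewrite -/c -/Z S_eq -[[set w | (~` S) (M w)]]/(~` [set w | S (M w)]).
rewrite probability_setC//.
have /fineK <- : P [set w | S (M w)] \is a fin_num by exact: fin_num_measure.
(* The total being 1 excludes infinite values and leaves [c + r = 1]. *)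
case: (\esum_(_ in Z `&` ~` S) _) => [r| |] // [] cr1.
rewrite -EFinB !lee_fin => rp cp; congr (_%:E); lra.
Qed.

End Distribution.

Theorem theorem3 (R : realType) (n : nat) (n_ge1 : (1 <= n)%N) :
  (* rho is a probability distribution on pairs of nonnegative integers *)
  [/\ forall k l : nat, 0 <= rho R n k l,
      \esum_(kl in [set: nat * nat]) (rho R n kl.1 kl.2)%:E = 1%E
    & (* any realization (K, L, M) of steps (i) and (ii) *)
      forall (d : measure_display) (Omega : measurableType d)
        (P : probability Omega R)
        (K L : {RV P >-> nat}) (M : {RV P >-> zmat}),
      (forall k l : nat,
         P [set w | K w = k /\ L w = l] = (rho R n k l)%:E) ->
      (forall k l : nat, P [set w | K w = k /\ L w = l] != 0%E ->
         forall A : 'M[bool]_(k, l), ones A = n ->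
         cond_prob P [set w | M w = to_zmat A] [set w | K w = k /\ L w = l] =
           #|[pred A' : 'M[bool]_(k, l) | ones A' == n]|%:R^-1) ->
      (* step (iii): the output is strip (M w) *)
      forall B : zmat, F1111_set n B ->
        P [set w | strip (M w) = B] = ((F1111 n)%:R^-1)%:E].
Proof.
split; [exact: rho_ge0 | exact: esum_rho |].
by move=> d Omega P K L M KL_rho M_unif B; exact: prob_strip KL_rho M_unif B.
Qed.
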